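(* Let $m\ge1$ be an integer and $b$ a complex number. Let $f_m(z,0,b)=\sum_{n\ge0}c(n,m,0,b)z^n$ be the unique formal power series with $f_m=1+bz^mf_m^2$ and $d_1^{(m)}(N,0,b)=\det\big(c(i+j+1,m,0,b)\big)_{i,j=0}^{N-1}$. Then for all $n\ge0$ $$d_1^{(m)}(mn,0,b)=(-1)^{\binom m2n}b^{mn^2},$$ and $d_1^{(m)}(N,0,b)=0$ for all $N$ not divisible by $m$.
   Context: The determinant of a $0\times0$ matrix is $1$. *)

(* Defs.v *)
From mathcomp Require Import all_boot all_order all_algebra.
Set Implicit Arguments.
Unset Strict Implicit.
Unset Printing Implicit Defensive.
Import GRing.Theory.
Local Open Scope ring_scope.

Section FormalPowerSeries.
Variable K : comNzRingType.

(* The series \sum_n (f n) z^n is given by its coefficient sequence; equality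
   of series is equality of all coefficients, written f =1 g. *)
Definition fps : Type := nat -> K.

Definition fps_one : fps := fun n => (n == 0%N)%:R.
Definition fps_Xn (m : nat) : fps := fun n => (n == m)%:R.
Definition fps_add (f g : fps) : fps := fun n => f n + g n.
Definition fps_scale (a : K) (f : fps) : fps := fun n => a * f n.
Definition fps_mul (f g : fps) : fps :=
  fun n => \sum_(k < n.+1) f k * g (n - k)%N.

Definition is_fm (m : nat) (b : K) (f : fps) : Prop :=
  f =1 fps_add fps_one (fps_scale b (fps_mul (fps_Xn m) (fps_mul f f))).

Definition d1 (c : fps) (N : nat) : K :=
  \det (\matrix_(i < N, j < N) c (i + j + 1)%N).

Lemma fps_mulXn (m : nat) (f : fps) (n : nat) :
  fps_mul (fps_Xn m) f n = if (m <= n)%N then f (n - m)%N else 0.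
Proof.
rewrite /fps_mul /fps_Xn; case: leqP => mn.
  rewrite (bigD1 (Ordinal (mn : m < n.+1)%N)) //= eqxx mul1r big1 ?addr0 // => k.
  by rewrite -val_eqE /= => /negbTE ->; rewrite mul0r.
by rewrite big1 // => k _; rewrite ltn_eqF ?mul0r // (leq_ltn_trans _ mn) // -ltnS.
Qed.

Lemma eq_fps_mul (n : nat) (f g : fps) :
  (forall k, (k <= n)%N -> f k = g k) -> fps_mul f f n = fps_mul g g n.
Proof.
by move=> fg; apply: eq_bigr => k _; rewrite !fg ?leq_subr // -ltnS.
Qed.

Lemma is_fm_unique (m : nat) (b : K) (f g : fps) :
  (1 <= m)%N -> is_fm m b f -> is_fm m b g -> f =1 g.
Proof.
move=> m1 hf hg n; elim/ltn_ind: n => n IH.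
rewrite hf hg /fps_add /fps_scale !fps_mulXn; case: leqP => // mn.
congr (_ + _ * _); apply: eq_fps_mul => k kn; apply: IH.
by rewrite (leq_ltn_trans kn) // ltn_subrL m1 (leq_trans m1).
Qed.

Lemma is_fm_exists (m : nat) (b : K) : (1 <= m)%N -> exists f, is_fm m b f.
Proof.
move=> m1.
pose F (f : fps) : fps :=
  fps_add fps_one (fps_scale b (fps_mul (fps_Xn m) (fps_mul f f))).
have FE (f g : fps) n : (forall k, (k < n)%N -> f k = g k) -> F f n = F g n.
  move=> fg; rewrite /F /fps_add /fps_scale !fps_mulXn; case: leqP => // mn.
  congr (_ + _ * _); apply: eq_fps_mul => k kn; apply: fg.
  by rewrite (leq_ltn_trans kn) // ltn_subrL m1 (leq_trans m1).
pose f : fps := fun n => iter n.+1 F fps_one n.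
have stab p n : (n < p)%N -> iter p F fps_one n = f n.
  elim/ltn_ind: n p => n IH [//|p] np; rewrite /f !iterS.
  by apply: FE => k kn; rewrite !IH // (leq_trans kn).
exists f => n; rewrite -/(F f n) {1}/f iterS.
by apply: FE => k kn; apply: stab.
Qed.

End FormalPowerSeries.

(* Main.v *)
(** Put [U = f_m^2]; squaring [f = 1 + b z^m f^2] gives
    [U = 1 + 2 b z^m U + b^2 z^(2m) U^2].  Writing [p = m k + s] with [s < m],
    let [L] be the lower unitriangular matrix with entries
    [L i p = [z^i] z^p U^(k+1)].  The equation for [U] becomes a three-term
    recurrence expressing row [i + m] of [L] in terms of row [i], whose
    tridiagonal operator is self-adjoint for the weights [b^(2k+1)].  Hence the form
    [S i j = sum_p b^(2k+1) L i p L j p'], with [p'] the mirror image of [p]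
    inside its block of length [m], satisfies [S (i+m) j = S i (j+m)], and
    checking [i < m] gives [S i j = c (i+j+1)].  So the Hankel matrix is
    [L M L^T] with [M] made of the blocks [b^(2k+1) J_m], [J_m] antidiagonal;
    when [m] does not divide [N], the truncated last block has a zero row. *)
Require Import Defs.
From mathcomp Require Import all_boot all_order all_algebra.
From mathcomp Require Import reals complex.
From mathcomp Require Import ring zify.
Import GRing.Theory.
Local Open Scope ring_scope.

(** * Polynomial truncation of the square of [f_m] *)

Lemma coefM_eq0_below {K : comNzRingType} {B : nat} {p : {poly K}} (q : {poly K}) :
  (forall i, (i < B)%N -> p`_i = 0) -> forall i, (i < B)%N -> (q * p)`_i = 0.
Proof.
move=> p0 i iB; rewrite coefM big1 // => j _.
by rewrite p0 ?mulr0 // (leq_ltn_trans (leq_subr _ _)).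
Qed.

(* Zero exactly when [U] satisfies the equation of the square of [f_m]; for a
   truncation of that square, only the low coefficients vanish. *)
Definition sqr_defect {K : comNzRingType} (m : nat) (b : K) (U : {poly K}) :
    {poly K} :=
  U - (1 + 2%:R * b%:P * ('X^m * U) + b%:P ^+ 2 * 'X^m * ('X^m * U ^+ 2)).

Lemma exists_sqr_trunc {K : comNzRingType} {m : nat} {b : K} {c : fps K} (B : nat) :
  is_fm m b c ->
  exists U : {poly K},
    (forall i, (i < B)%N -> (sqr_defect m b U)`_i = 0) /\
    (forall i, (0 < i < B)%N -> c i = b * ('X^m * U)`_i).
Proof.
move=> hc; pose F := \poly_(i < B) c i.
have cF i : (i < B)%N -> c i = (1 + b%:P * ('X^m * F ^+ 2))`_i.
  move=> iB; rewrite hc /fps_add /fps_scale fps_mulXn coefD coef1 /fps_one.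
  rewrite coefCM coefXnM; case: ltnP => // mi.
  congr (_ + _ * _); rewrite expr2 coefM; apply: eq_bigr => j _.
  by rewrite !coef_poly !ifT //; have := ltn_ord j; lia.
exists (F ^+ 2); split=> i; last first.
  by case/andP=> i0 iB; rewrite cF // coefD coef1 coefCM gtn_eqF // add0r.
(* A difference of squares, since the equation for [U] reads [U = (1 + b z^m U)^2]; its second
   factor vanishes below degree [B]. *)
have -> : sqr_defect m b (F ^+ 2) =
    (F + 1 + b%:P * ('X^m * F ^+ 2)) * (F - (1 + b%:P * ('X^m * F ^+ 2))).
  by rewrite /sqr_defect; ring.
apply: coefM_eq0_below => j jB.
by rewrite coefB -cF // coef_poly jB subrr.
Qed.

(** * Columns of [L] as polynomials, and their recurrences *)

Definition lcol {K : comNzRingType} (m : nat) (U : {poly K}) (k s : nat) :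
    {poly K} :=
  'X^(m * k + s) * U ^+ k.+1.

Lemma lcol_eq0 {K : comNzRingType} {m : nat} (U : {poly K}) {k s i : nat} :
  (i < m * k + s)%N -> (lcol m U k s)`_i = 0.
Proof. by move=> lt; rewrite coefXnM lt. Qed.

Lemma lcolS_rec {K : comNzRingType} {m B : nat} {b : K} {U : {poly K}} :
  (forall i, (i < B)%N -> (sqr_defect m b U)`_i = 0) ->
  forall k s i, (i + m < B)%N ->
  (lcol m U k.+1 s)`_(i + m) = (lcol m U k s)`_i
    + 2%:R * b * (lcol m U k.+1 s)`_i + b ^+ 2 * (lcol m U k.+2 s)`_i.
Proof.
move=> hU k s i iB.
have E : lcol m U k.+1 s = 'X^m * (lcol m U k s
    + (2%:R * b)%:P * lcol m U k.+1 s + (b ^+ 2)%:P * lcol m U k.+2 s)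
    + 'X^(m * k.+1 + s) * U ^+ k.+1 * sqr_defect m b U.
  rewrite /lcol /sqr_defect !mulnS !exprD !polyC_exp !polyCM !exprS polyC_natr.
  by ring.
rewrite {1}E coefD (coefM_eq0_below _ hU _ iB) addr0 coefXnM.
by rewrite ltnNge leq_addl /= addnK !coefD !coefCM.
Qed.

(** In block 0 the constant term of the equation for [U] leaves the bare monomial ['X^s]. It
    accounts for the identity in the first [m] rows and, when [s < m], drops out of all later
    ones. *)
Lemma lcol0E {K : comNzRingType} (m : nat) (b : K) (U : {poly K}) (s : nat) :
  lcol m U 0 s = 'X^m * ((2%:R * b)%:P * lcol m U 0 s
    + (b ^+ 2)%:P * lcol m U 1 s) + 'X^s + 'X^s * sqr_defect m b U.
Proof.
rewrite /lcol /sqr_defect !mulnS !muln0 !exprD !polyC_exp !polyCM !exprS polyC_natr.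
by ring.
Qed.

Lemma lcol0_rec {K : comNzRingType} {m B : nat} {b : K} {U : {poly K}} :
  (forall i, (i < B)%N -> (sqr_defect m b U)`_i = 0) ->
  forall s i, (s < m)%N -> (i + m < B)%N ->
  (lcol m U 0 s)`_(i + m) =
    2%:R * b * (lcol m U 0 s)`_i + b ^+ 2 * (lcol m U 1 s)`_i.
Proof.
move=> hU s i sm iB.
rewrite {1}(lcol0E m b) coefD (coefM_eq0_below _ hU _ iB) addr0 coefD.
rewrite coefXn gtn_eqF ?addr0; last by lia.
by rewrite coefXnM ltnNge leq_addl /= addnK !coefD !coefCM.
Qed.

Lemma lcol0_init {K : comNzRingType} {m B : nat} {b : K} {U : {poly K}} :
  (forall i, (i < B)%N -> (sqr_defect m b U)`_i = 0) ->
  forall s i, (i < m)%N -> (i < B)%N -> (lcol m U 0 s)`_i = (i == s)%:R.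
Proof.
move=> hU s i im iB.
by rewrite {1}(lcol0E m b) coefD (coefM_eq0_below _ hU _ iB) addr0 coefD
  coefXn coefXnM im add0r.
Qed.

Lemma lcol_diag {K : comNzRingType} {m : nat} {U : {poly K}} (k s : nat) :
  U`_0 = 1 -> (lcol m U k s)`_(m * k + s) = 1.
Proof.
move=> U0; rewrite coefXnM ltnn subnn.
by rewrite -horner_coef0 horner_exp horner_coef0 U0 expr1n.
Qed.

(* The tridiagonal operator of the Pascal-type recurrence is self-adjoint for
   the weights [b ^+ (2 * k + 1)]; [x T = y T = 0] kills the boundary term. *)
Lemma tridiag_selfadjoint {K : comNzRingType} {b : K} {T : nat}
    (x y x' y' : nat -> K) :
  (forall k, x' k.+1 = x k + 2%:R * b * x k.+1 + b ^+ 2 * x k.+2) ->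
  x' 0 = 2%:R * b * x 0 + b ^+ 2 * x 1%N ->
  (forall k, y' k.+1 = y k + 2%:R * b * y k.+1 + b ^+ 2 * y k.+2) ->
  y' 0 = 2%:R * b * y 0 + b ^+ 2 * y 1%N ->
  x T = 0 -> y T = 0 ->
  \sum_(k < T) b ^+ (2 * k + 1) * (x' k * y k) =
  \sum_(k < T) b ^+ (2 * k + 1) * (x k * y' k).
Proof.
move=> x'S x'0 y'S y'0 xT yT; case: T xT yT => [|T] xT yT.
  by rewrite !big_ord0.
(* Truncating after index [n] leaves a discrete Wronskian of [x] and [y]. *)
suff H n : \sum_(k < n.+1) b ^+ (2 * k + 1) * (x' k * y k) =
  \sum_(k < n.+1) b ^+ (2 * k + 1) * (x k * y' k)
   + b ^+ (2 * n + 3) * (x n.+1 * y n - x n * y n.+1).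
  by rewrite H xT yT; ring.
elim: n => [|n IH]; first by rewrite !big_ord1 x'0 y'0 /=; ring.
rewrite big_ord_recr [in RHS]big_ord_recr /= IH x'S y'S.
by rewrite !mulnS !exprD; ring.
Qed.

(** * Triangular factorisation of the Hankel matrix *)

Lemma hankel_lcol {K : comNzRingType} {m B : nat} {b : K} {c : fps K} {U : {poly K}} :
  (forall i, (i < B)%N -> (sqr_defect m b U)`_i = 0) ->
  (forall i, (0 < i < B)%N -> c i = b * ('X^m * U)`_i) ->
  (0 < m)%N ->
  forall T i j, (i + j < T)%N -> (i + j + 1 < B)%N ->
  \sum_(k < T) \sum_(s < m)
    b ^+ (2 * k + 1) * ((lcol m U k s)`_i * (lcol m U k (m.-1 - s))`_j)
  = c (i + j + 1)%N.
Proof.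
move=> hU hc m0 T i; elim/ltn_ind: i => i IH j ijT ijB.
case: (ltnP i m) => im.
  (* Row [i < m] of [L] is a unit vector, so only [k = 0], [s = i] survives. *)
  case: T ijT {IH} => // T _; rewrite big_ord_recl [X in _ + X]big1 ?addr0; last first.
    move=> k _; rewrite big1 // => s _; rewrite lcol_eq0 ?mul0r ?mulr0 //=.
    by rewrite /bump /= add1n mulnS; lia.
  rewrite (bigD1 (Ordinal im)) //= [X in _ + X]big1 ?addr0; last first.
    move=> s; rewrite -val_eqE /= => si.
    by rewrite (lcol0_init hU) // ?(eq_sym i) ?(negbTE si) ?mul0r ?mulr0 //; lia.
  rewrite (lcol0_init hU) ?eqxx ?mul1r //; last by lia.
  rewrite hc; last by lia.
  rewrite /lcol !coefXnM !expr1 muln0 add0n.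
  have -> : (j < m.-1 - i)%N = (i + j + 1 < m)%N by lia.
  by case: ifP => // _; congr (_ * _`__); lia.
(* Self-adjointness, applied for each fixed [s], moves a shift by [m] from [i] to [j]. Block [T]
   starts beyond rows [i - m] and [j], so the boundary term is zero. *)
have -> : (i + j + 1 = (i - m) + (j + m) + 1)%N by lia.
rewrite -IH; [|lia..].
rewrite exchange_big [RHS]exchange_big; apply: eq_bigr => s _ /=.
have sm := ltn_ord s.
have mT : (T <= m * T)%N by rewrite leq_pmull.
rewrite -{1}(subnK im).
apply: (tridiag_selfadjoint (fun k => (lcol m U k s)`_(i - m))
   (fun k => (lcol m U k (m.-1 - s))`_j)
   (fun k => (lcol m U k s)`_(i - m + m))
   (fun k => (lcol m U k (m.-1 - s))`_(j + m))) => [k||k|||].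
- by apply: (lcolS_rec hU); lia.
- by apply: (lcol0_rec hU); lia.
- by apply: (lcolS_rec hU); lia.
- by apply: (lcol0_rec hU); lia.
- by rewrite lcol_eq0 //; lia.
- by rewrite lcol_eq0 //; lia.
Qed.

Definition block_rev (m p : nat) : nat := (m * (p %/ m) + (m.-1 - p %% m))%N.

Lemma block_revMDl {m : nat} (n : nat) (p : 'I_m) :
  block_rev m (m * n + p) = (m * n + (m.-1 - p))%N.
Proof.
have m0 : (0 < m)%N := leq_ltn_trans (leq0n p) (ltn_ord p).
rewrite (mulnC m n) /block_rev divnMDl // modnMDl divn_small // modn_small //.
by rewrite addn0 mulnC.
Qed.

Definition middle_mx {K : comNzRingType} (m : nat) (b : K) (N : nat) : 'M[K]_N :=
  \matrix_(p < N, q < N)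
    (if q == block_rev m p :> nat then b ^+ (2 * (p %/ m) + 1) else 0).

Lemma d1_middle_mx {K : comNzRingType} {m : nat} {b : K} {c : fps K} (N : nat) :
  (0 < m)%N -> is_fm m b c -> d1 c N = \det (middle_mx m b N).
Proof.
(* The bound exceeds every index [i + j + 1], and stays positive for [N = 0], as [U0] requires. *)
move=> m0 hc; have [U [hU hcU]] := exists_sqr_trunc (2 * N + 1)%N hc.
have U0 : U`_0 = 1.
  by have := lcol0_init hU 0 0 m0; rewrite /lcol muln0 mul1r; apply; lia.
pose V p i := (lcol m U (p %/ m) (p %% m))`_i.
have pE p : (m * (p %/ m) + p %% m = p)%N by rewrite mulnC -divn_eq.
have V0 p i : (i < p)%N -> V p i = 0 by move=> ip; rewrite /V lcol_eq0 ?pE.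
pose L : 'M[K]_N := \matrix_(i, p) V p i.
have detL : \det L = 1.
  rewrite det_trig; last first.
    by apply/is_trig_mxP => i j ij; rewrite mxE V0.
  by rewrite big1 // => i _; rewrite mxE /V -{3}(pE i) lcol_diag.
suff HE : \matrix_(i < N, j < N) c (i + j + 1)%N = L *m middle_mx m b N *m L^T.
  by rewrite /d1 HE !det_mulmx det_tr detL mul1r mulr1.
apply/matrixP => i j; rewrite mxE.
have iN := ltn_ord i; have jN := ltn_ord j.
rewrite -(hankel_lcol hU hcU m0 (2 * N)); [|lia..].
pose G p := b ^+ (2 * (p %/ m) + 1) * (V p i * V (block_rev m p) j).
transitivity (\sum_(0 <= p < 2 * N * m) G p).
  rewrite big_nat_mul big_mkord; apply: eq_bigr => k _.
  rewrite -{1}[(k * m)%N]add0n big_addn mulSn addnK big_mkord.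
  apply: eq_bigr => s _; rewrite /G /V /block_rev.
  have sm := ltn_ord s.
  have rm : (m.-1 - s < m)%N by lia.
  rewrite [(s + _)%N]addnC !divnMDl // !modnMDl !(divn_small sm) !(modn_small sm) addn0.
  by rewrite (mulnC m) divnMDl // modnMDl (divn_small rm) (modn_small rm) addn0.
transitivity (\sum_(p < N) G p).
  rewrite big_mkord (big_ord_widen _ G (_ : N <= 2 * N * m)%N); last by nia.
  rewrite [RHS]big_mkcond; apply: eq_bigr => p _ /=.
  by case: ltnP => // pN; rewrite /G V0 ?mul0r ?mulr0 //; lia.
rewrite -mulmxA mxE; apply: eq_bigr => p _; rewrite !mxE /G mulrCA; congr (_ * _).
(* The mirror of [p] may lie outside the matrix. Then row [p] of [middle_mx] is zero, and so is the
   [V] factor, by triangularity. *)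
case: (ltnP (block_rev m p) N) => rN.
  rewrite (bigD1 (Ordinal rN)) //= !mxE eqxx big1 ?addr0 // => q.
  by rewrite -val_eqE !mxE /= => /negbTE ->; rewrite mul0r.
rewrite V0 ?mulr0; last by lia.
by rewrite big1 // => q _; rewrite !mxE ltn_eqF ?mul0r // (leq_trans _ rN).
Qed.

(** * Determinant of the middle factor *)

Definition antidiag_mx (K : comNzRingType) (m : nat) : 'M[K]_m :=
  \matrix_(i < m, j < m) (j == m.-1 - i :> nat)%N%:R.

Lemma det_antidiag_mx (K : comNzRingType) (m : nat) :
  \det (antidiag_mx K m) = (-1) ^+ 'C(m, 2).
Proof.
elim: m => [|m IH]; first by rewrite det_mx00.
(* The corner entry has cofactor sign [(-1) ^+ m], matching Pascal's rule for ['C(m.+1, 2)]. *)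
rewrite (expand_det_row _ ord0) (bigD1 ord_max) //= big1 ?addr0; last first.
  by move=> j; rewrite -val_eqE mxE /= subn0 => /negbTE ->; rewrite mul0r.
rewrite mxE /= subn0 eqxx mul1r /cofactor add0n binS bin1 addnC exprD -IH.
congr (_ * \det _); apply/matrixP => i j; rewrite !mxE /= /bump /=.
have jm : (j < m)%N := ltn_ord j.
rewrite leqNgt jm add0n; congr ((_ == _)%:R); lia.
Qed.

Lemma det_middle_mx {K : comNzRingType} {m : nat} (b : K) (n : nat) :
  (0 < m)%N ->
  \det (middle_mx m b (m * n)) = (-1) ^+ ('C(m, 2) * n) * b ^+ (m * n ^ 2).
Proof.
move=> m0; elim: n => [|n IH].
  by rewrite !muln0 det_mx00 mulr1.
have -> : \det (middle_mx m b (m * n.+1)) = \det (middle_mx m b (m * n + m)).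
  by rewrite mulnS addnC.
have -> : middle_mx m b (m * n + m) =
  block_mx (middle_mx m b (m * n)) 0 0 (b ^+ (2 * n + 1) *: antidiag_mx K m).
  apply/matrixP => i j; rewrite !mxE.
  case: (splitP i) => p ip; rewrite !mxE; case: (splitP j) => q jq; rewrite !mxE ip jq //.
  - rewrite gtn_eqF // /block_rev.
    have pm : (p %/ m < n)%N by rewrite ltn_divLR // (mulnC n).
    apply: (@leq_trans (m * (p %/ m).+1)); first by rewrite mulnS; lia.
    by rewrite (leq_trans _ (leq_addr _ _)) // leq_mul2l pm orbT.
  - by rewrite block_revMDl ltn_eqF // (leq_trans (ltn_ord q)) ?leq_addr.
  - rewrite block_revMDl eqn_add2l {1}(mulnC m) divnMDl // divn_small // addn0.
    by case: eqP; rewrite ?mulr1 ?mulr0.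
(* The new block contributes [b ^+ ((2 * n + 1) * m)], and [n^2 + (2 n + 1) = (n + 1)^2]. *)
rewrite det_lblock detZ det_antidiag_mx IH -exprM [X in _ * X]mulrC mulrACA.
rewrite -!exprD -mulnSr; congr (_ * b ^+ _).
by rewrite -!mulnn; lia.
Qed.

Lemma det_middle_mx_eq0 {K : comNzRingType} {m : nat} (b : K) (N : nat) :
  (0 < m)%N -> ~~ (m %| N)%N -> \det (middle_mx m b N) = 0.
Proof.
move=> m0 mN; have r0 : (0 < N %% m)%N by rewrite lt0n.
have rm : (N %% m < m)%N by rewrite ltn_mod.
have NE := divn_eq N m.
(* The zero row is the first one of the incomplete block: its mirror is the last index of the full
   block, hence at least [N]. *)
have pN : (N %/ m * m < N)%N by lia.
rewrite (expand_det_row _ (Ordinal pN)) big1 // => q _; rewrite mxE /=.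
rewrite /block_rev mulnK // modnMl subn0 ltn_eqF ?mul0r //.
by have := ltn_ord q; lia.
Qed.

Theorem theorem5p6 (R : realType) (m : nat) (b : R[i]) (c : fps R[i]) :
  (1 <= m)%N ->
  is_fm m b c ->
  (forall n : nat, d1 c (m * n) = (-1) ^+ ('C(m, 2) * n) * b ^+ (m * n ^ 2)) /\
  (forall N : nat, ~~ (m %| N)%N -> d1 c N = 0).
Proof.
move=> m1 hc; split=> [n|N mN]; rewrite (d1_middle_mx _ m1 hc).
  exact: det_middle_mx.
exact: det_middle_mx_eq0.
Qed.
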